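(* Let $d$ be a metric on $\mathfrak H_{\mathbb K}$, and denote again by $d$ its extension to $\partial\mathbf{H}^n_{\mathbb K}=\mathfrak H_{\mathbb K}\cup\{\infty\}$. Suppose that both of the following hold: (Sim) $\mathrm{Sim}_{d_{\mathfrak H}}\subseteq\mathrm{Sim}_d$; (Top) every sequence $(p_\nu)_{\nu\in\mathbb N}$ in $\partial\mathbf{H}^n_{\mathbb K}$ which converges in the $d_{\mathfrak H}$-topology of $\partial\mathbf{H}^n_{\mathbb K}$ converges in the $d$-topology of $\partial\mathbf{H}^n_{\mathbb K}$. Then: 1. If $\mathbb K=\mathbb R$, there exist constants $\beta>0$ and $\alpha\in(0,1]$ such that $d=\beta\cdot d_{\mathfrak H}^{\alpha}$. 2. If $\mathbb K\neq\mathbb R$, there exist constants $\alpha\in(0,1]$ and $\beta>0$ such that $d(p,q)\le\beta\cdot d_{\mathfrak H}^{\alpha}(p,q)$ for all $p,q\in\partial\mathbf{H}^n_{\mathbb K}$.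
   Context: $\mathbb K$ is one of $\mathbb R,\mathbb C,\mathbb H,\mathbb O$ (reals, complex numbers, quaternions, octonions), with conjugation $z\mapsto\overline z$ (the identity if $\mathbb K=\mathbb R$) and norm $|z|$; $n\ge 2$ is an integer, and $n=2$ if $\mathbb K=\mathbb O$. Put $\Im(\mathbb K)=\{z\in\mathbb K: z=-\overline z\}$, $\operatorname{Im}z=(z-\overline z)/2$, and $\|\zeta\|^2=\sum_i|\zeta_i|^2$ for $\zeta\in\mathbb K^{n-1}$. The $\mathbb K$-Heisenberg group $\mathfrak H_{\mathbb K}$ is the set $\mathbb K^{n-1}\times\Im(\mathbb K)$ with the multiplication $(\zeta,v)*(\zeta',v')=(\zeta+\zeta',\,v+v'+2\omega(\zeta,\zeta'))$, where $\omega(\zeta,\zeta')=\operatorname{Im}\big(\sum_i\overline{\zeta'_i}\zeta_i\big)$; thus $(\zeta,v)^{-1}=(-\zeta,-v)$, and the origin is $o=(0,0)$. The boundary of $\mathbb K$-hyperbolic space is identified with $\partial\mathbf{H}^n_{\mathbb K}=\mathfrak H_{\mathbb K}\cup\{\infty\}$. The Korányi gauge is $|(\zeta,v)|_{\mathbb K}=(\|\zeta\|^4+|v|^2)^{1/4}$ and the Korányi metric is $d_{\mathfrak H}(p,q)=|q^{-1}*p|_{\mathbb K}$ on $\mathfrak H_{\mathbb K}$. Any metric $d$ on $S=\mathfrak H_{\mathbb K}$ (in particular $d_{\mathfrak H}$) is extended to $\overline S=S\cup\{\infty\}$ by $d(p,\infty)=+\infty$ for $p\in S$ and $d(\infty,\infty)=0$.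 The $d$-topology on $\overline S$ is the one extending the metric topology of $S$ for which the sets $\{q\in S:d(o,q)>R\}\cup\{\infty\}$, $R>0$, are basic neighbourhoods of $\infty$. For pairwise distinct $p_1,\dots,p_4\in\overline S$ the metric cross-ratio is $|\mathbb X^d|(p_1,p_2,p_3,p_4)=\frac{d(p_4,p_2)}{d(p_4,p_1)}\cdot\frac{d(p_3,p_1)}{d(p_3,p_2)}$, where, if one of the points is $\infty$, the two factors containing $\infty$ are cancelled. The Möbius group $\mathcal M_d$ is the group of homeomorphisms of $\overline S$ (in the $d$-topology) which leave $|\mathbb X^d|$ invariant on all quadruples of pairwise distinct points. The similarity group $\mathrm{Sim}_d$ is the set of $\phi\in\mathcal M_d$ for which there is a constant $K(\phi)>0$ with $d(\phi(p),\phi(q))=K(\phi)\,d(p,q)$ for all $p,q\in S$. *)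

(* Defs.v *)
From HB Require Import structures.
From mathcomp Require Import all_boot all_order all_algebra.
From mathcomp Require Import complex.
From mathcomp Require Import all_classical all_reals all_analysis.

Set Implicit Arguments.
Unset Strict Implicit.
Unset Printing Implicit Defensive.

Import Order.TTheory GRing.Theory Num.Theory.
Import numFieldNormedType.Exports.

Local Open Scope classical_set_scope.
Local Open Scope ring_scope.

(* The product is not assumed associative, so that the octonions fit. *)
Record conjAlg (R : realType) := ConjAlg {
  car :> lmodType R;
  kmul : car -> car -> car;
  kconj : {linear car -> car};
  kconjK : involutive kconj;
  knorm : car -> R }.

Section algebras.
Variable R : realType.

Definition real_alg : conjAlg R :=
  @ConjAlg R R^o (fun x y : R => x * y) (@idfun R^o) (fun=> erefl)
    (fun x : R => `|x|).

(* [Rcomplex R] is R[i] as an R-algebra. *)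
Definition complex_alg : conjAlg R :=
  @ConjAlg R (Rcomplex R) (fun x y : R[i] => x * y)
    (@conjc R : Rcomplex R -> Rcomplex R) (@conjcK R) (@ComplexField.Normc.normc R).

Section doubling.
Variable A : conjAlg R.

Definition dbl_mul (x y : A * A) : A * A :=
  (kmul x.1 y.1 - kmul (kconj A y.2) x.2,
   kmul y.2 x.1 + kmul x.2 (kconj A y.1)).

Definition dbl_conj (x : A * A) : A * A := (kconj A x.1, - x.2).

Lemma dbl_conj_linear : linear dbl_conj.
Proof.
move=> a [x1 x2] [y1 y2]; rewrite /dbl_conj /=; congr (_, _) => /=.
  by rewrite linearP.
by rewrite opprD scalerN.
Qed.

HB.instance Definition _ :=
  GRing.isLinear.Build R (A * A)%type (A * A)%type *:%R dbl_conj
    dbl_conj_linear.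

Lemma dbl_conjK : involutive dbl_conj.
Proof. by move=> [x y]; rewrite /dbl_conj /= kconjK opprK. Qed.

Definition dbl_norm (x : A * A) : R :=
  Num.sqrt (knorm x.1 ^+ 2 + knorm x.2 ^+ 2).

(* Cayley-Dickson: (a, b)(c, d) = (ac - d^* b, da + b c^* ). *)
Definition doubling : conjAlg R :=
  @ConjAlg R (A * A)%type dbl_mul dbl_conj dbl_conjK dbl_norm.

End doubling.

Definition quaternion_alg : conjAlg R := doubling complex_alg.
Definition octonion_alg : conjAlg R := doubling quaternion_alg.

End algebras.

Inductive algLabel := RealK | ComplexK | QuaternionK | OctonionK.

Definition alg (R : realType) (K : algLabel) : conjAlg R :=
  match K with
  | RealK => real_alg R
  | ComplexK => complex_alg R
  | QuaternionK => quaternion_alg R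
  | OctonionK => octonion_alg R
  end.

Section imaginary.
Variables (R : realType) (A : conjAlg R).

Definition is_imag (z : A) : bool := z == - kconj A z.

Definition imK : Type := {z : A | is_imag z}.
HB.instance Definition _ := Choice.on imK.

Definition im (z : A) : A := 2^-1 *: (z - kconj A z).

Lemma is_imag0 : is_imag 0.
Proof. by rewrite /is_imag linear0 oppr0. Qed.

Lemma is_imagD (x y : A) : is_imag x -> is_imag y -> is_imag (x + y).
Proof. by rewrite /is_imag linearD opprD => /eqP <- /eqP <-. Qed.

Lemma is_imagN (x : A) : is_imag x -> is_imag (- x).
Proof. by rewrite /is_imag linearN eqr_opp. Qed.

Lemma is_imagZ (a : R) (x : A) : is_imag x -> is_imag (a *: x).
Proof. by rewrite /is_imag linearZ -scalerN => /eqP <-. Qed.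

Lemma is_imag_im (z : A) : is_imag (im z).
Proof. by apply: is_imagZ; rewrite /is_imag linearB kconjK opprB. Qed.

End imaginary.

Section heisenberg.
Variables (R : realType) (A : conjAlg R) (n : nat).

Definition heis : Type := ('rV[A]_(n.-1) * imK A)%type.
HB.instance Definition _ := Choice.on heis.

Definition heis0 : heis := (0, exist (@is_imag R A) 0 (is_imag0 A)).

Definition omega (z z' : 'rV[A]_(n.-1)) : A :=
  im (\sum_i kmul (kconj A (z' 0 i)) (z 0 i)).

Definition heis_mul (p q : heis) : heis :=
  (p.1 + q.1,
   exist (@is_imag R A) (sval p.2 + sval q.2 + 2 *: omega p.1 q.1)
     (is_imagD (is_imagD (svalP p.2) (svalP q.2))
        (is_imagZ 2 (is_imag_im _)))).

Definition heis_inv (p : heis) : heis :=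
  (- p.1, exist (@is_imag R A) (- sval p.2) (is_imagN (svalP p.2))).

Definition vnorm (z : 'rV[A]_(n.-1)) : R :=
  Num.sqrt (\sum_i knorm (z 0 i) ^+ 2).

Definition koranyi_gauge (p : heis) : R :=
  (vnorm p.1 ^+ 4 + knorm (sval p.2) ^+ 2) `^ 4^-1.

Definition d_heis (p q : heis) : R := koranyi_gauge (heis_mul (heis_inv q) p).

End heisenberg.

Arguments heis0 {R A n}.
Arguments d_heis {R A n}.

Record is_metric (R : realType) (S : Type) (d : S -> S -> R) : Prop := IsMetric {
  is_metric_ge0 : forall p q, 0 <= d p q;
  is_metric_eq0 : forall p q, d p q = 0 <-> p = q;
  is_metric_sym : forall p q, d p q = d q p;
  is_metric_triangle : forall p q r, d p r <= d p q + d q r }.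

(* S u {oo}, where [None] is the point at infinity. *)
Section extension.
Variables (R : realType) (S : choiceType) (o : S) (d : S -> S -> R).

Definition dext (p q : option S) : \bar R :=
  match p, q with
  | Some x, Some y => (d x y)%:E
  | None, None => 0%E
  | _, _ => +oo%E
  end.

(* [d] and [o] are phantom arguments, on which the topology instance depends. *)
Definition dspace of (S -> S -> R) & S : Type := option S.
Local Notation T := (dspace d o).
HB.instance Definition _ := Choice.copy T (option S).

(* When [d] is a metric, the sets {d o > r} u {oo} are open and form a
   neighbourhood basis of oo. *)
Definition dopen (U : set (option S)) : Prop :=
  (forall p, U (Some p) ->
     exists2 r : R, 0 < r & forall q, d p q < r -> U (Some q)) /\
  (U None -> exists2 r : R, 0 < r & forall q, r < d o q -> U (Some q)).

Lemma dopenT : dopen setT.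
Proof. by split=> *; exists 1. Qed.

Lemma dopenI : setI_closed dopen.
Proof.
move=> U V [U1 U2] [V1 V2]; split.
  move=> p [/U1[r r0 Ur] /V1[s s0 Vs]]; exists (Num.min r s).
    by rewrite lt_min r0.
  by move=> q; rewrite lt_min => /andP[? ?]; split; [exact: Ur|exact: Vs].
move=> [/U2[r r0 Ur] /V2[s s0 Vs]]; exists (Num.max r s).
  by rewrite lt_max r0.
by move=> q; rewrite gt_max => /andP[? ?]; split; [exact: Ur|exact: Vs].
Qed.

Lemma dopen_bigU (I : Type) (f : I -> set (option S)) :
  (forall i, dopen (f i)) -> dopen (\bigcup_i f i).
Proof.
move=> fo; split.
  by move=> p [i _ /(fo i).1[r r0 fr]]; exists r => // q /fr; exists i.
by move=> [i _ /(fo i).2[r r0 fr]]; exists r => // q /fr; exists i.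
Qed.

HB.instance Definition _ :=
  @isOpenTopological.Build T dopen dopenT dopenI dopen_bigU.

Definition dcvg (p : nat -> option S) : Prop :=
  exists x : T, (p : nat -> T) @ \oo --> x.

Definition dhomeo (f : option S -> option S) : Prop :=
  exists g : option S -> option S,
    [/\ cancel f g, cancel g f,
        continuous (f : T -> T) & continuous (g : T -> T)].

(* A factor involving oo counts as 1: on pairwise distinct points this cancels
   the two factors of the cross-ratio containing oo. *)
Definition xfactor (p q : option S) : R :=
  if (p, q) is (Some x, Some y) then d x y else 1.

Definition xratio (p1 p2 p3 p4 : option S) : R :=
  xfactor p4 p2 / xfactor p4 p1 * (xfactor p3 p1 / xfactor p3 p2).

Definition Mobius : set (option S -> option S) :=
  [set f | dhomeo f /\
    forall p1 p2 p3 p4, uniq [:: p1; p2; p3; p4] ->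
      xratio (f p1) (f p2) (f p3) (f p4) = xratio p1 p2 p3 p4].

Definition Sim : set (option S -> option S) :=
  [set f | Mobius f /\
    exists2 k : R, 0 < k & forall p q : S,
      dext (f (Some p)) (f (Some q)) = (k%:E * dext (Some p) (Some q))%E].

End extension.

(* Main.v *)
From HB Require Import structures.
Require Import Defs.
From mathcomp Require Import all_boot all_order all_algebra.
From mathcomp Require Import complex ring lra.
From mathcomp Require Import all_classical all_reals all_analysis.

(** Left translations [heis_mul s] and dilations [dil r] are similarities of the
    Koranyi metric (for the continuity of translations at infinity, a
    quasi-triangle inequality of the gauge is enough), so they multiply [d] by
    constants.

    Translations preserve [d]: conjugating the translation by [s] with the
    dilation by [2] gives the translation by [dil 2 s], which has the same
    constant [k].  If [s = (z, 0)] is horizontal, [dil 2 s] is the square of [s],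
    so [k ^+ 2 = k] and [k = 1]; if [s = (0, v)] is vertical, it is the fourth
    power of [s] and again [k = 1].  Horizontal and vertical elements generate
    the group.

    The constant [k r] of [dil r] is multiplicative in [r].  By the
    hypothesis on converging sequences, the identity is continuous at the origin
    from the Koranyi metric to [d] ([dcvg_modulus]), so the constants
    [k r ^+ m] of the powers of a contraction tend to [0] and [k r < 1] for
    [r < 1].  A multiplicative function with this property is a power [r `^ a]
    with [0 < a].  The triangle inequality between [heis0], [e] and
    [e * e = dil 2 e], with [e] horizontal, gives [2 `^ a <= 2], that is
    [a <= 1] ([dilation_exponent]).

    For the upper bound, let [t] be such that points of gauge less than [t] are
    at [d]-distance less than [1] from the origin; rescaling a point of nonzero
    gauge to gauge [t / 2] gives
    [d heis0 p <= (2 / t) `^ a * koranyi_gauge p `^ a]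
    ([d_le_powR]).  No compactness is needed.

    In the real case the group is a Euclidean space and reflections are
    involutive isometries, hence have constant [1] for [d].  Any two
    points of a sphere centred at the origin are exchanged by a reflection, so
    [d heis0 p] depends only on the gauge of [p]; by homogeneity it is a multiple
    of its power [`^ a] ([d_eq_powR]). *)

Set Implicit Arguments.
Unset Strict Implicit.
Unset Printing Implicit Defensive.
Import Order.TTheory GRing.Theory Num.Theory.
Import numFieldNormedType.Exports.
Local Open Scope classical_set_scope.
Local Open Scope ring_scope.

(** * Similarities and topologies of extended spaces *)

Section similarities.
Variables (R : realType) (S : choiceType) (o : S) (d : S -> S -> R).
Implicit Types (f g : S -> S) (k : R).

(** [f q] tends to infinity, as measured by [d o], when [q] does. *)
Definition proper_at_infty f :=
  forall r : R, exists2 s : R, 0 < s & forall q, s < d o q -> r < d o (f q).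

Lemma continuous_omap f k : 0 < k -> (forall p q, d (f p) (f q) = k * d p q) ->
  proper_at_infty f -> continuous (omap f : dspace d o -> dspace d o).
Proof.
move=> k0 fk fp; apply/continuousP => U [U1 U2]; split.
  move=> p /= /U1[r r0 Ur]; exists (r / k); first exact: divr_gt0.
  by move=> q pq; apply: Ur; rewrite fk mulrC -ltr_pdivlMr.
move=> /= /U2[r r0 Ur]; have [s s0 fs] := fp r.
by exists s => // q /fs; exact: Ur.
Qed.

Lemma xratio_omap f k : 0 < k -> (forall p q, d (f p) (f q) = k * d p q) ->
  forall p1 p2 p3 p4, uniq [:: p1; p2; p3; p4] ->
  xratio d (omap f p1) (omap f p2) (omap f p3) (omap f p4)
    = xratio d p1 p2 p3 p4.
Proof.
move=> k0 fk p1 p2 p3 p4.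
have kk a b : k * a / (k * b) = a / b.
  by rewrite invfM mulrACA divff ?gt_eqF// mul1r.
case: p1 => [p1|]; case: p2 => [p2|]; case: p3 => [p3|]; case: p4 => [p4|];
  rewrite /= ?in_cons ?eqxx ?orbT ?andbF //= => _;
  rewrite /xratio /xfactor /= ?fk ?kk // ?divr1 ?div1r ?mulr1 ?mul1r ?kk //.
- by rewrite !(mulrC _^-1) kk.
Qed.

(** The homotheties of [d] which are proper at infinity, and whose inverses
    are, extend to similarities fixing infinity. *)
Lemma Sim_omap f g k : 0 < k -> cancel f g -> cancel g f ->
  (forall p q, d (f p) (f q) = k * d p q) ->
  proper_at_infty f -> proper_at_infty g -> Sim o d (omap f).
Proof.
move=> k0 fg gf fk fp gp.
have gk p q : d (g p) (g q) = k^-1 * d p q.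
  by rewrite -[in RHS](gf p) -[in RHS](gf q) fk mulKf ?gt_eqF.
split; last by exists k => // p q; rewrite /= fk.
split; last exact: xratio_omap fk.
exists (omap g); split.
- by case=> //= p; rewrite fg.
- by case=> //= p; rewrite gf.
- exact: continuous_omap fk fp.
- by apply: continuous_omap gk gp; rewrite invr_gt0.
Qed.

Lemma Sim_omap_scale f : Sim o d (omap f) ->
  exists2 k : R, 0 < k & forall p q, d (f p) (f q) = k * d p q.
Proof. by move=> [_ [k k0 fk]]; exists k => // p q; case: (fk p q). Qed.

Lemma cvg_Some (u : nat -> S) :
  (forall e : R, 0 < e -> \forall n \near \oo, d o (u n) < e) ->
  (fun n => Some (u n) : dspace d o) @ \oo --> (Some o : dspace d o).
Proof.
move=> du U [V [[V1 _] /V1[r r0 Vr] VU]].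
by apply: filterS (du _ r0) => n /Vr /VU.
Qed.

End similarities.

Section topology.
Variables (R : realType) (S : choiceType) (o : S) (d : S -> S -> R).

Hypothesis d_metric : is_metric d.

Let doo : d o o = 0. Proof. by apply/(is_metric_eq0 d_metric). Qed.

(** A converging sequence which visits a point [o] infinitely often
    converges to it: the topology of a metric is Hausdorff. *)
Lemma dcvg_visits (u : nat -> option S) : dcvg o d u ->
  (forall m, exists2 n, (m <= n)%N & u n = Some o) ->
  forall e : R, 0 < e ->
    \forall n \near \oo, exists2 q, u n = Some q & d o q < e.
Proof.
move=> [x ux] uo e e0.
have xE : x = Some o.
  apply: contrapT => xo.
  pose U : set (dspace d o) := fun y => y != Some o.
  have dU : dopen o d U.
    split=> [p pU|_]; last first.
      by exists 1 => // q q1; apply/eqP => -[qo]; move: q1; rewrite qo doo ltr10.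
    exists (d p o) => [|q pq].
      rewrite lt_def (is_metric_ge0 d_metric) andbT.
      by apply/eqP => /(is_metric_eq0 d_metric) po; move: pU; rewrite /U po eqxx.
    by apply/eqP => -[qo]; move: pq; rewrite qo ltxx.
  have /ux [m _ um] : nbhs x U by exists U; split=> //; exact/eqP.
  by have [n mn un] := uo m; have := um n mn; rewrite /U /= un eqxx.
pose U : set (dspace d o) := [set y | exists2 q, y = Some q & d o q < e].
apply: (ux U); exists U; split => //; last by rewrite xE; exists o => //; rewrite doo.
split=> [p [_ [<-] pe]|[]//]; exists (e - d o p); first by rewrite subr_gt0.
move=> q pq; exists q => //.
by apply: le_lt_trans (is_metric_triangle d_metric o p q) _; rewrite -ltrBrDl.
Qed.

(** If every sequence converging for [d'] converges for [d], then the identity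
    is continuous at [o]: interleaving a sequence tending to [o] with the
    constant sequence [o] identifies its [d]-limit. *)
Lemma dcvg_modulus (d' : S -> S -> R) : d' o o = 0 ->
  (forall p : nat -> option S, dcvg o d' p -> dcvg o d p) ->
  forall e : R, 0 < e ->
    exists2 r : R, 0 < r & forall q, d' o q < r -> d o q < e.
Proof.
move=> d'oo top e e0; apply: contrapT => nr.
have /choice[u uP] (n : nat) : exists q, d' o q < n.+1%:R^-1 /\ e <= d o q.
  apply: contrapT => nq; apply: nr; exists n.+1%:R^-1; first by rewrite invr_gt0.
  by move=> q qn; rewrite ltNge; apply/negP => eq; apply: nq; exists q.
have du r : 0 < r -> \forall n \near \oo, d' o (u n) < r.
  move=> r0; have := near_infty_natSinv_lt (PosNum r0).
  by apply: filterS => n; apply: lt_trans; case: (uP n).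
pose v n := if odd n then u n./2 else o.
have /top dv : dcvg o d' (fun n => Some (v n)).
  exists (Some o); apply: cvg_Some => r r0.
  have [m _ um] := du _ r0; exists m.*2 => // n /= mn; rewrite /v.
  by case: ifP => _; rewrite ?d'oo //; apply: um; rewrite /= -(doubleK m) half_leq.
have [m _ vm] : \forall n \near \oo, exists2 q, Some (v n) = Some q & d o q < e.
  apply: (dcvg_visits dv) => // m; exists m.*2; first by rewrite -addnn leq_addr.
  by rewrite /v odd_double.
have [|_ [<-]] := vm m.*2.+1; first by rewrite /= -addnn leqW // leq_addr.
by rewrite /v /= odd_double /= uphalf_double ltNge; case: (uP m) => _ ->.
Qed.

End topology.

(** * Normed algebras with conjugation *)

(** The properties common to the four algebras on which the argument rests.
    The norm is only asked to be subadditive and submultiplicative up to a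
    constant, in terms of squares, so that the property passes from an algebra
    to its Cayley-Dickson double, with no associativity involved. *)
Record normed_conjAlg (R : realType) (A : conjAlg R) : Prop := NormedConjAlg {
  kmulDl : forall x y z : A, kmul (x + y) z = kmul x z + kmul y z;
  kmulDr : forall x y z : A, kmul x (y + z) = kmul x y + kmul x z;
  kmulZl : forall (a : R) (x y : A), kmul (a *: x) y = a *: kmul x y;
  kmulZr : forall (a : R) (x y : A), kmul x (a *: y) = a *: kmul x y;
  kconj_sq : forall x : A,
    kconj A (kmul (kconj A x) x) = kmul (kconj A x) x;
  knorm_ge0 : forall x : A, 0 <= knorm x;
  knormZ : forall (a : R) (x : A), knorm (a *: x) = `|a| * knorm x;
  knorm_conj : forall x : A, knorm (kconj A x) = knorm x;
  knormD : forall x y : A, knorm (x + y) ^+ 2 <= 2 * (knorm x ^+ 2 + knorm y ^+ 2);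
  knormM : exists2 C : R, 0 <= C & forall x y : A,
    knorm (kmul x y) ^+ 2 <= C * (knorm x ^+ 2 * knorm y ^+ 2);
  kneq0 : exists x : A, x != 0 }.

Lemma sqrD_le (R : realType) (x y : R) :
  (x + y) ^+ 2 <= 2 * (x ^+ 2 + y ^+ 2).
Proof. by have := sqr_ge0 (x - y); nra. Qed.

Lemma normed_real (R : realType) : normed_conjAlg (real_alg R).
Proof.
split.
- by move=> x y z; exact: mulrDl.
- by move=> x y z; exact: mulrDr.
- by move=> a x y; rewrite /GRing.scale /= mulrA.
- by move=> a x y; rewrite /GRing.scale /= mulrCA.
- by [].
- by move=> x /=.
- by move=> a x /=; exact: normrM.
- by [].
- by move=> x y /=; rewrite !real_normK ?num_real// sqrD_le.
- by exists 1 => // x y /=; rewrite normrM exprMn mul1r.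
- by exists 1; exact: oner_neq0.
Qed.

Lemma normed_complex (R : realType) : normed_conjAlg (complex_alg R).
Proof.
split.
- by move=> x y z; exact: mulrDl.
- by move=> x y z; exact: mulrDr.
- move=> a [x1 x2] [y1 y2]; apply/eqP; rewrite eq_complex /=.
  by apply/andP; split; apply/eqP; ring.
- move=> a [x1 x2] [y1 y2]; apply/eqP; rewrite eq_complex /=.
  by apply/andP; split; apply/eqP; ring.
- move=> [x1 x2]; apply/eqP; rewrite eq_complex /=.
  by apply/andP; split; apply/eqP; ring.
- by move=> [x1 x2] /=; exact: sqrtr_ge0.
- move=> a [x1 x2] /=; rewrite -sqrtr_sqr -sqrtrM ?sqr_ge0 //.
  by congr Num.sqrt; ring.
- by move=> [x1 x2] /=; rewrite sqrrN.
- move=> [x1 x2] [y1 y2] /=; rewrite !sqr_sqrtr ?addr_ge0 ?sqr_ge0 //.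
  by have := sqrD_le x1 y1; have := sqrD_le x2 y2; lra.
- exists 1 => // -[x1 x2] [y1 y2] /=.
  rewrite !sqr_sqrtr ?addr_ge0 ?sqr_ge0 // mul1r.
  by rewrite le_eqVlt; apply/orP; left; apply/eqP; ring.
- by exists 1; exact: oner_neq0.
Qed.

Lemma normed_doubling (R : realType) (A : conjAlg R) :
  normed_conjAlg A -> normed_conjAlg (doubling A).
Proof.
case=> mDl mDr mZl mZr cs n0 nZ nc nD [C C0 nM] [x0 x00].
have mN (x y : A) : kmul (- x) y = - kmul x y by rewrite -scaleN1r mZl scaleN1r.
have mNr (x y : A) : kmul x (- y) = - kmul x y by rewrite -scaleN1r mZr scaleN1r.
have nN (x : A) : knorm (- x) = knorm x.
  by rewrite -scaleN1r nZ normrN1 mul1r.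
have sq (x : doubling A) : knorm x ^+ 2 = knorm x.1 ^+ 2 + knorm x.2 ^+ 2.
  by rewrite /= sqr_sqrtr ?addr_ge0 ?sqr_ge0.
have pair_eq (x y : doubling A) : x.1 = y.1 -> x.2 = y.2 -> x = y.
  by case: x y => [? ?] [? ?] /= -> ->.
split.
- move=> x y z; apply: pair_eq => /=.
    by rewrite mDl mDr opprD addrACA.
  by rewrite mDl mDr addrACA.
- move=> x y z; apply: pair_eq => /=.
    by rewrite linearD mDl mDr opprD addrACA.
  by rewrite linearD mDl mDr addrACA.
- move=> a x y; apply: pair_eq => /=.
    by rewrite mZl mZr scalerBr.
  by rewrite mZl mZr scalerDr.
- move=> a x y; apply: pair_eq => /=.
    by rewrite linearZ mZl mZr scalerBr.
  by rewrite linearZ mZl mZr scalerDr.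
- move=> x; apply: pair_eq => /=.
    by rewrite mNr opprK linearD !cs.
  by rewrite mN subrr oppr0.
- by move=> x; exact: sqrtr_ge0.
- move=> a x /=; rewrite /dbl_norm /= !nZ -[X in X * Num.sqrt _]sqrtr_sqr -sqrtrM ?sqr_ge0 //.
  by rewrite !exprMn real_normK ?num_real // mulrDr.
- by move=> x; rewrite /= /dbl_norm /= nc nN.
- move=> x y; rewrite !sq.
  by have := nD x.1 y.1; have := nD x.2 y.2; rewrite /=; lra.
- exists (2 * C) => [|x y]; first exact: mulr_ge0.
  rewrite !sq /= .
  have := nD (kmul x.1 y.1) (- kmul (kconj A y.2) x.2).
  have := nD (kmul y.2 x.1) (kmul x.2 (kconj A y.1)).
  have := nM x.1 y.1; have := nM (kconj A y.2) x.2.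
  have := nM y.2 x.1; have := nM x.2 (kconj A y.1).
  rewrite nN !nc; lra.
- by exists (x0, 0); apply: contra_neq x00 => -[].
Qed.

Lemma normed_alg (R : realType) (K : algLabel) : normed_conjAlg (alg R K).
Proof.
case: K; [exact: normed_real|exact: normed_complex| |].
  exact/normed_doubling/normed_complex.
exact/normed_doubling/normed_doubling/normed_complex.
Qed.

(** * The Heisenberg group and its Koranyi gauge *)

(** Scaling of a row of vectors of [A] by a real number: the scaling of matrices
    is only available by elements of the ring of their entries. *)
Definition scale_row (R : realType) (A : conjAlg R) (m : nat) (a : R)
  (z : 'rV[A]_m) : 'rV[A]_m := map_mx (fun u : A => a *: u) z.

Section heisenberg_group.
Variables (R : realType) (A : conjAlg R) (n : nat).
Hypothesis hA : normed_conjAlg A.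
Local Notation H := (heis A n).
Implicit Types (p q s x y : H) (z w : 'rV[A]_(n.-1)) (a r : R).

Local Notation "a *:: z" := (scale_row a z) (at level 40).

Lemma scale_rowE a z i : (a *:: z) 0 i = a *: z 0 i.
Proof. by rewrite mxE. Qed.

Lemma scale_rowDr a z w : a *:: (z + w) = a *:: z + a *:: w.
Proof. by apply/rowP => i; rewrite !mxE scalerDr. Qed.

Lemma scale_row0 a : a *:: (0 : 'rV[A]_(n.-1)) = 0.
Proof. by apply/rowP => i; rewrite !mxE scaler0. Qed.

Lemma scale_0row z : 0 *:: z = 0.
Proof. by apply/rowP => i; rewrite !mxE scale0r. Qed.

Lemma scale_1row z : 1 *:: z = z.
Proof. by apply/rowP => i; rewrite !mxE scale1r. Qed.

Lemma scale_rowA a r z : a *:: (r *:: z) = (a * r) *:: z.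
Proof. by apply/rowP => i; rewrite !mxE scalerA. Qed.

Lemma scale_rowN z : (-1) *:: z = - z.
Proof. by apply/rowP => i; rewrite !mxE scaleN1r. Qed.

Lemma heis_ext p q : p.1 = q.1 -> sval p.2 = sval q.2 -> p = q.
Proof. by case: p q => [z v] [w v'] /= -> /val_inj ->. Qed.

Lemma imD (u v : A) : im (u + v) = im u + im v.
Proof. by rewrite /im (linearD (kconj A)) opprD addrACA scalerDr. Qed.

Lemma imZ a (u : A) : im (a *: u) = a *: im u.
Proof. by rewrite /im [kconj A _]linearZ -scalerBr !scalerA mulrC. Qed.

Lemma omegaDl z z' w : omega (z + z') w = omega z w + omega z' w.
Proof.
rewrite /omega -imD -big_split /=; congr im; apply: eq_bigr => i _.
by rewrite mxE (kmulDr hA).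
Qed.

Lemma omegaDr z w w' : omega z (w + w') = omega z w + omega z w'.
Proof.
rewrite /omega -imD -big_split /=; congr im; apply: eq_bigr => i _.
by rewrite mxE (linearD (kconj A)) (kmulDl hA).
Qed.

Lemma omegaZl a z w : omega (a *:: z) w = a *: omega z w.
Proof.
rewrite /omega -imZ scaler_sumr; congr im; apply: eq_bigr => i _.
by rewrite scale_rowE (kmulZr hA).
Qed.

Lemma omegaZr a z w : omega z (a *:: w) = a *: omega z w.
Proof.
rewrite /omega -imZ scaler_sumr; congr im; apply: eq_bigr => i _.
by rewrite scale_rowE [kconj A _]linearZ (kmulZl hA).
Qed.

Lemma omega0l w : omega 0 w = 0.
Proof. by rewrite -(scale_0row 0) omegaZl scale0r. Qed.

Lemma omega0r z : omega z 0 = 0.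
Proof. by rewrite -(scale_0row 0) omegaZr scale0r. Qed.

Lemma omega_self z : omega z z = 0.
Proof.
rewrite /omega /im (linear_sum (kconj A)) -sumrB big1 ?scaler0 // => i _.
by rewrite (kconj_sq hA) subrr.
Qed.

Lemma heis_mulA : associative (@heis_mul R A n).
Proof.
move=> p q s; apply: heis_ext => /=; first by rewrite addrA.
rewrite omegaDl omegaDr !scalerDr !addrA.
rewrite -!addrA; congr (_ + (_ + _)).
by rewrite [RHS]addrCA; congr (_ + _); rewrite addrC -addrA.
Qed.

Lemma heis_mul0 p : heis_mul p heis0 = p.
Proof. by apply: heis_ext; rewrite /= ?omega0r ?scaler0 !addr0. Qed.

Lemma heis_0mul p : heis_mul heis0 p = p.
Proof. by apply: heis_ext; rewrite /= ?omega0l ?scaler0 ?addr0 add0r. Qed.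

Lemma heis_mulV p : heis_mul p (heis_inv p) = heis0.
Proof.
apply: heis_ext; rewrite /= subrr //.
by rewrite -scale_rowN omegaZr omega_self !scaler0 addr0.
Qed.

Lemma heis_Vmul p : heis_mul (heis_inv p) p = heis0.
Proof.
apply: heis_ext; rewrite /= addNr //.
by rewrite -scale_rowN omegaZl omega_self !scaler0 addr0.
Qed.

Lemma heis_mulK p : cancel (heis_mul p) (heis_mul (heis_inv p)).
Proof. by move=> q; rewrite heis_mulA heis_Vmul heis_0mul. Qed.

Lemma heis_mulVK p : cancel (heis_mul (heis_inv p)) (heis_mul p).
Proof. by move=> q; rewrite heis_mulA heis_mulV heis_0mul. Qed.

Lemma d_heis_mul s p q : d_heis (heis_mul s p) (heis_mul s q) = d_heis p q.
Proof.
rewrite /d_heis; congr koranyi_gauge.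
apply: (can_inj (heis_mulK (heis_mul s q))).
rewrite heis_mulA heis_mulV heis_0mul.
by rewrite -heis_mulA [heis_mul q _]heis_mulA heis_mulV heis_0mul.
Qed.

(** The dilation by [r], an automorphism of the group if [r != 0]. *)
Definition dil r p : H :=
  (r *:: p.1, exist (@is_imag R A) (r ^+ 2 *: sval p.2)
               (is_imagZ (r ^+ 2) (svalP p.2))).

Lemma dil_mul r p q : dil r (heis_mul p q) = heis_mul (dil r p) (dil r q).
Proof.
apply: heis_ext => /=; first by rewrite scale_rowDr.
rewrite omegaZl omegaZr !scalerDr !scalerA; congr (_ + _ *: _).
by rewrite (mulrC 2) expr2.
Qed.

Lemma dilM r a p : dil r (dil a p) = dil (r * a) p.
Proof. by apply: heis_ext; rewrite /= ?scale_rowA // scalerA exprMn. Qed.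

Lemma dil1 p : dil 1 p = p.
Proof. by apply: heis_ext; rewrite /= ?scale_1row // expr1n scale1r. Qed.

Lemma dil0 r : dil r heis0 = heis0.
Proof. by apply: heis_ext; rewrite /= ?scale_row0 ?scaler0. Qed.

Lemma dilV r p : dil r (heis_inv p) = heis_inv (dil r p).
Proof. by apply: heis_ext; rewrite /= ?scalerN // -!scale_rowN !scale_rowA mulrC. Qed.

Lemma dilK r : r != 0 -> cancel (dil r) (dil r^-1).
Proof. by move=> r0 p; rewrite dilM mulVf // dil1. Qed.

Lemma dilVK r : r != 0 -> cancel (dil r^-1) (dil r).
Proof. by move=> r0 p; rewrite dilM mulfV // dil1. Qed.

Lemma knormN (u : A) : knorm (- u) = knorm u.
Proof. by rewrite -scaleN1r (knormZ hA) normrN1 mul1r. Qed.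

Lemma vnorm_sq z : vnorm z ^+ 2 = \sum_i knorm (z 0 i) ^+ 2.
Proof. by rewrite sqr_sqrtr // sumr_ge0 // => i _; rewrite sqr_ge0. Qed.

Lemma vnorm_ge0 z : 0 <= vnorm z. Proof. exact: sqrtr_ge0. Qed.

Lemma vnormZ a z : vnorm (a *:: z) = `|a| * vnorm z.
Proof.
rewrite -[X in X * _]sqrtr_sqr -sqrtrM ?sqr_ge0 // mulr_sumr; congr Num.sqrt.
by apply: eq_bigr => i _; rewrite scale_rowE (knormZ hA) exprMn real_normK ?num_real.
Qed.

Lemma gauge_ge0 p : 0 <= koranyi_gauge p. Proof. exact: powR_ge0. Qed.

Lemma gauge4 p :
  koranyi_gauge p ^+ 4 = vnorm p.1 ^+ 4 + knorm (sval p.2) ^+ 2.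
Proof.
rewrite -powR_mulrn ?powR_ge0 // -powRrM mulVf ?pnatr_eq0 // powRr1 //.
by rewrite addr_ge0 ?exprn_ge0 ?vnorm_ge0 ?(knorm_ge0 hA).
Qed.

Lemma gauge_dil r p : 0 <= r -> koranyi_gauge (dil r p) = r * koranyi_gauge p.
Proof.
move=> r0; apply/eqP; rewrite -(@eqrXn2 _ 4) ?gauge_ge0 ?mulr_ge0 ?gauge_ge0 //.
rewrite exprMn !gauge4 /= vnormZ (knormZ hA) ger0_norm // ger0_norm ?sqr_ge0 //.
by apply/eqP; ring.
Qed.

Lemma gauge_inv p : koranyi_gauge (heis_inv p) = koranyi_gauge p.
Proof.
rewrite /koranyi_gauge /= knormN; congr ((_ ^+ 4 + _) `^ _).
by rewrite -scale_rowN vnormZ normrN1 mul1r.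
Qed.

Lemma d_heis0 p : d_heis heis0 p = koranyi_gauge p.
Proof. by rewrite /d_heis heis_mul0 gauge_inv. Qed.

Lemma gauge0 : koranyi_gauge (heis0 : H) = 0.
Proof. by rewrite -(dil0 0) gauge_dil // mul0r. Qed.

Lemma d_heis_dil r p q : 0 <= r -> d_heis (dil r p) (dil r q) = r * d_heis p q.
Proof. by move=> r0; rewrite /d_heis -dilV -dil_mul gauge_dil. Qed.

Lemma knorm_sum (I : Type) (t : seq I) : exists2 C : R, 0 <= C &
  forall F : I -> A, knorm (\sum_(i <- t) F i) ^+ 2
    <= C * \sum_(i <- t) knorm (F i) ^+ 2.
Proof.
elim: t => [|i t [C C0 IH]].
  exists 0 => // F; rewrite !big_nil -(scale0r 0) (knormZ hA).
  by rewrite normr0 !mul0r expr0n.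
exists (2 + 2 * C) => [|F]; first by rewrite addr_ge0 ?mulr_ge0.
rewrite !big_cons; have := knormD hA (F i) (\sum_(j <- t) F j); have := IH F.
have : 0 <= \sum_(j <- t) knorm (F j) ^+ 2.
  by apply: sumr_ge0 => j _; exact: sqr_ge0.
have := sqr_ge0 (knorm (F i)); nra.
Qed.

Lemma knorm_omega : exists2 C : R, 0 <= C & forall z w,
  knorm (omega z w) ^+ 2 <= C * (vnorm z ^+ 2 * vnorm w ^+ 2).
Proof.
have [C C0 hC] := knorm_sum (index_enum 'I_(n.-1)).
have [D D0 hD] := knormM hA.
exists (C * D) => [|z w]; first exact: mulr_ge0.
set u : A := \sum_i kmul (kconj A (w 0 i)) (z 0 i).
have -> : omega z w = im u by [].
have : knorm (im u) ^+ 2 <= knorm u ^+ 2.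
  rewrite /im (knormZ hA) exprMn.
  have -> : `|2^-1 : R| ^+ 2 = 4^-1.
    by rewrite ger0_norm ?invr_ge0 // exprVn -natrX.
  by have := knormD hA u (- kconj A u); rewrite knormN (knorm_conj hA); lra.
move/le_trans; apply; apply: (le_trans (hC _)); rewrite -mulrA.
apply: ler_wpM2l => //; rewrite !vnorm_sq mulr_suml mulr_sumr.
apply: ler_sum => i _; apply: (le_trans (hD _ _)); apply: ler_wpM2l => //.
rewrite (knorm_conj hA) mulrC; apply: ler_wpM2l; first exact: sqr_ge0.
rewrite (bigD1 i) //= lerDl; apply: sumr_ge0 => j _; exact: sqr_ge0.
Qed.

(** The quasi-triangle inequality of the Koranyi gauge. *)
Lemma gauge_mul : exists2 C : R, 0 < C & forall p q,
  koranyi_gauge (heis_mul p q) ^+ 4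
    <= C * (koranyi_gauge p ^+ 4 + koranyi_gauge q ^+ 4).
Proof.
have [D D0 hD] := knorm_omega.
exists (8 + 4 * D) => [|p q]; first by rewrite ltr_wpDr ?mulr_ge0.
have sqr_sqr (x : R) : x ^+ 4 = (x ^+ 2) ^+ 2 by rewrite -exprM.
rewrite !gauge4 /= !sqr_sqr.
have h1 := hD p.1 q.1.
have h2 := knormD hA (sval p.2) (sval q.2).
have h3 := knormD hA (sval p.2 + sval q.2) (2 *: omega p.1 q.1).
rewrite (knormZ hA) exprMn ger0_norm // -natrX in h3.
have h4 : vnorm (p.1 + q.1) ^+ 2 <= 2 * (vnorm p.1 ^+ 2 + vnorm q.1 ^+ 2).
  rewrite !vnorm_sq -big_split mulr_sumr /=; apply: ler_sum => i _.
  by rewrite mxE; exact: (knormD hA).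
have W0 := sqr_ge0 (vnorm (p.1 + q.1)).
have P0 := sqr_ge0 (knorm (sval p.2)); have Q0 := sqr_ge0 (knorm (sval q.2)).
move: h1 h2 h3 h4 W0 P0 Q0.
move: (vnorm (p.1 + q.1) ^+ 2) (vnorm p.1 ^+ 2) (vnorm q.1 ^+ 2) => w wp wq.
move: (knorm (sval p.2) ^+ 2) (knorm (sval q.2) ^+ 2) => vp vq.
move: (knorm (omega _ _) ^+ 2) (knorm (sval p.2 + sval q.2) ^+ 2) => om v.
move: (knorm _ ^+ 2) => t h1 h2 h3 h4 w0 vp0 vq0.
have h5 : w ^+ 2 <= 8 * (wp ^+ 2 + wq ^+ 2).
  apply: (@le_trans _ _ ((2 * (wp + wq)) ^+ 2)).
    by rewrite ler_sqr ?nnegrE // (le_trans w0).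
  by rewrite exprMn -natrX; have := sqrD_le wp wq; lra.
have h6 : om <= D * ((wp ^+ 2 + wq ^+ 2) / 2).
  apply: (le_trans h1); apply: ler_wpM2l => //.
  by have := sqr_ge0 (wp - wq); lra.
have h7 : 0 <= D * vp by exact: mulr_ge0.
have h8 : 0 <= D * vq by exact: mulr_ge0.
lra.
Qed.

Lemma proper_dil r : 0 < r -> proper_at_infty heis0 d_heis (dil r).
Proof.
move=> r0 t; exists (Num.max 1 (t / r)) => [|q]; first by rewrite lt_max ltr01.
rewrite gt_max => /andP[_]; rewrite ltr_pdivrMr //.
by rewrite !d_heis0 gauge_dil ?ltW // mulrC.
Qed.

Lemma Sim_dil r : 0 < r -> Sim heis0 d_heis (omap (dil r)).
Proof.
move=> r0; apply: (@Sim_omap _ _ _ _ _ (dil r^-1) r) => //.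
- by apply: dilK; rewrite gt_eqF.
- by apply: dilVK; rewrite gt_eqF.
- by move=> p q; apply: d_heis_dil; exact: ltW.
- exact: proper_dil.
- by apply: proper_dil; rewrite invr_gt0.
Qed.

(** By the quasi-triangle inequality for [q = s^-1 * (s * q)], if [s * q] stays
    bounded then so does [q]. *)
Lemma proper_heis_mul s : proper_at_infty heis0 d_heis (heis_mul s).
Proof.
have [C C0 hC] := gauge_mul.
move=> t; pose M := C * (koranyi_gauge s ^+ 4 + `|t| ^+ 4).
have M0 : 0 <= M.
  apply: mulr_ge0; first exact: ltW.
  by apply: addr_ge0; apply: exprn_ge0; [exact: gauge_ge0|exact: normr_ge0].
exists (1 + M) => [|q]; first by rewrite ltr_wpDr.
rewrite !d_heis0 => Mq; rewrite ltNge; apply/negP => qt.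
have := hC (heis_inv s) (heis_mul s q); rewrite heis_mulK gauge_inv.
apply/negP; rewrite -ltNge.
have qt4 : koranyi_gauge (heis_mul s q) ^+ 4 <= `|t| ^+ 4.
  by apply: lerXn2r; rewrite ?nnegrE ?gauge_ge0 // (le_trans qt) ?ler_norm.
have q1 : 1 <= koranyi_gauge q by rewrite (le_trans _ (ltW Mq)) // lerDl.
have := ler_eXnr (isT : (0 < 4)%N) q1.
have : C * koranyi_gauge (heis_mul s q) ^+ 4 <= C * `|t| ^+ 4.
  by rewrite ler_pM2l.
rewrite /M in Mq; lra.
Qed.

Lemma Sim_heis_mul s : Sim heis0 d_heis (omap (heis_mul s)).
Proof.
apply: (@Sim_omap _ _ _ _ _ (heis_mul (heis_inv s)) 1) => //.
- exact: heis_mulK.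
- exact: heis_mulVK.
- by move=> p q; rewrite mul1r d_heis_mul.
- exact: proper_heis_mul.
- exact: proper_heis_mul.
Qed.

End heisenberg_group.

(** * Multiplicative functions of a positive variable *)

(** Such an [f] is increasing, and linear on the rationals. *)
Lemma additive_linear (R : realType) (f : {additive R -> R}) :
  (forall x, x < 0 -> f x < 0) -> forall x, f x = f 1 * x.
Proof.
move=> f_lt0.
have f_ratr q : f (ratr q) = f 1 * ratr q.
  have den0 : (denq q)%:~R != 0 :> R by rewrite intr_eq0 denq_neq0.
  have qE : ratr q * (denq q)%:~R = (numq q)%:~R :> R by rewrite /ratr mulfVK.
  apply: (mulIf den0); rewrite mulrzr -raddfMz -mulrzr -[RHS]mulrA qE.
  by rewrite raddfMz mulrzr.
have f_mono x y : x < y -> f x < f y.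
  by move=> xy; rewrite -subr_lt0 -raddfB f_lt0 // subr_lt0.
have f1_gt0 : 0 < f 1 by rewrite -(raddf0 f) f_mono.
move=> x; apply/eqP; rewrite eq_le !leNgt; apply/andP; split; apply/negP.
  rewrite mulrC -ltr_pdivlMr // => /rat_in_itvoo[q]; rewrite in_itv /=.
  case/andP => /f_mono xq; rewrite ltr_pdivlMr // mulrC -f_ratr.
  by move/(lt_trans xq); rewrite ltxx.
rewrite mulrC -ltr_pdivrMr // => /rat_in_itvoo[q]; rewrite in_itv /=.
case/andP => + /f_mono qx; rewrite ltr_pdivrMr // mulrC -f_ratr.
by move/lt_trans/(_ qx); rewrite ltxx.
Qed.

Lemma multiplicative_powR (R : realType) (k : R -> R) :
  (forall r : R, 0 < r -> 0 < k r) ->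
  (forall r s : R, 0 < r -> 0 < s -> k (r * s) = k r * k s) ->
  (forall r : R, 0 < r -> r < 1 -> k r < 1) ->
  exists2 a : R, 0 < a & forall r : R, 0 < r -> k r = r `^ a.
Proof.
move=> k0 kM k1; pose f x := ln (k (expR x)).
have fB : zmod_morphism f.
  move=> x y; apply/eqP; rewrite eq_sym subr_eq /f -lnM ?posrE ?k0 ?expR_gt0 //.
  by rewrite -kM ?expR_gt0 // -expRD subrK.
pose F : {additive R -> R} := HB.pack f (GRing.isZmodMorphism.Build R R f fB).
have fE := @additive_linear R F.
have f_lt0 x : x < 0 -> F x < 0.
  move=> x0; rewrite /= /f ln_lt0 // k0 ?expR_gt0 //=.
  by rewrite k1 ?expR_gt0 // expR_lt1.
exists (f 1).
  by rewrite -[f 1]opprK -(raddfN F) oppr_gt0 f_lt0 // oppr_lt0.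
move=> r r0; rewrite /powR gt_eqF // -fE //= /f !lnK ?posrE ?k0 ?expR_gt0 //.
Qed.


Lemma exists_horizontal (R : realType) (A : conjAlg R) (n : nat) :
  normed_conjAlg A -> (2 <= n)%N ->
  exists2 e : heis A n, e != heis0 & heis_mul e e = dil 2 e.
Proof.
move=> hA n_ge2; have [x x0] := kneq0 hA.
exists (const_mx x, (heis0 : heis A n).2).
  have n1_gt0 : (0 < n.-1)%N by rewrite -subn1 subn_gt0.
  by apply: contra_neq x0 => -[/rowP/(_ (Ordinal n1_gt0))]; rewrite !mxE.
apply: heis_ext => /=; last by rewrite omega_self // !scaler0 !addr0.
by apply/rowP => i; rewrite !mxE scaler_nat.
Qed.

(** * Metrics with the similarities of the Koranyi metric *)

Section invariant_metrics.
Variables (R : realType) (A : conjAlg R) (n : nat).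
Hypothesis hA : normed_conjAlg A.
Local Notation H := (heis A n).
Implicit Types (p q s x y : H) (r : R).
Variable d : H -> H -> R.
Hypothesis d_metric : is_metric d.

Lemma d_xx p : d p p = 0. Proof. exact/(is_metric_eq0 d_metric). Qed.

Lemma d_gt0 p q : p != q -> 0 < d p q.
Proof.
move=> pq; rewrite lt_def (is_metric_ge0 d_metric) andbT.
by apply: contra_neq pq => /(is_metric_eq0 d_metric).
Qed.

(** [f] multiplies all the distances [d] by [k]. *)
Definition scales (f : H -> H) (k : R) := forall p q, d (f p) (f q) = k * d p q.

Lemma scales_iter f k m : scales f k -> scales (iter m f) (k ^+ m).
Proof.
move=> fk; elim: m => [|m IH] p q; first by rewrite mul1r.
by rewrite iterS fk IH mulrA exprS.
Qed.

Hypothesis HSim : Sim heis0 d_heis `<=` Sim heis0 d.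
Hypothesis HTop : forall p : nat -> option H,
  dcvg heis0 d_heis p -> dcvg heis0 d p.
Variable e : H.
Hypothesis e_neq0 : e != heis0.
Hypothesis e_horizontal : heis_mul e e = dil 2 e.

Let e_gt0 : 0 < d heis0 e. Proof. by apply: d_gt0; rewrite eq_sym. Qed.

(** Conjugation by the dilation by [2] does not change the constant [k] of the
    translation by [s], and turns it here into its power [m.+2]. *)
Lemma scales_heis_mul_powers s m :
  dil 2 s = iter m.+2 (heis_mul s) heis0 -> scales (heis_mul s) 1.
Proof.
move=> sE.
have [k k0 sk] := Sim_omap_scale (HSim (Sim_heis_mul hA s)).
have two0 : (0 : R) < 2 by [].
have [l l0 dl] := Sim_omap_scale (HSim (Sim_dil n hA two0)).
have sdil x : iter m.+2 (heis_mul s) (dil 2 x) = dil 2 (heis_mul s x).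
  rewrite dil_mul // sE; elim: m.+2 => [|j IH]; first by rewrite heis_0mul.
  by rewrite !iterS IH heis_mulA.
have : k ^+ m.+1 == 1.
  have : k ^+ m.+2 = k.
    apply: (mulIf (lt0r_neq0 (mulr_gt0 l0 e_gt0))).
    by rewrite -dl -(scales_iter m.+2 sk) !sdil !dl sk mulrCA.
  rewrite exprS => kk; apply/eqP; apply: (mulfI (lt0r_neq0 k0)).
  by rewrite kk mulr1.
by rewrite pexpr_eq1 // ?ltW // => /eqP k1 p q; rewrite sk k1.
Qed.

(** Every point is the product of a vertical point, whose fourth power is its
    dilate by [2], and of a horizontal one, whose square is its dilate by [2]. *)
Lemma d_left_invariant s p q : d (heis_mul s p) (heis_mul s q) = d p q.
Proof.
pose v : H := (0, s.2); pose z : H := (s.1, (heis0 : H).2).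
have -> : s = heis_mul v z.
  by apply: heis_ext; rewrite /= ?add0r // omega0l // scaler0 !addr0.
have v1 : scales (heis_mul v) 1.
  apply: (@scales_heis_mul_powers _ 2); apply: heis_ext => /=.
    by rewrite scale_row0 !addr0.
  rewrite !omega0l // !scaler0 !addr0 -natrX scaler_nat.
  by rewrite -[(2 ^ 2)%N]/4%N !mulrS mulr0n addr0.
have z1 : scales (heis_mul z) 1.
  apply: (@scales_heis_mul_powers _ 0); apply: heis_ext => /=.
    by rewrite addr0; apply/rowP => i; rewrite !mxE scaler_nat.
  by rewrite omega0r // [s.1 + 0]addr0 omega_self // !scaler0 !addr0.
by rewrite -!heis_mulA // v1 z1 !mul1r.
Qed.

(** The dilations act on [d] with an exponent in [(0, 1]]. *)
Lemma dilation_exponent :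
  exists a : R, [/\ 0 < a, a <= 1 &
    forall r p, 0 < r -> d heis0 (dil r p) = r `^ a * d heis0 p].
Proof.
pose k r := d heis0 (dil r e) / d heis0 e.
have dk r p : 0 < r -> d heis0 (dil r p) = k r * d heis0 p.
  move=> r0; have [l l0 dl] := Sim_omap_scale (HSim (Sim_dil n hA r0)).
  by rewrite /k -[in X in X / _](dil0 A n r) -[in LHS](dil0 A n r) // !dl mulfK // gt_eqF.
have k_gt0 r : 0 < r -> 0 < k r.
  move=> r0; have [l l0 dl] := Sim_omap_scale (HSim (Sim_dil n hA r0)).
  by rewrite /k -[in X in X / _](dil0 A n r) dl mulfK // gt_eqF.
have kM r (t : R) : 0 < r -> 0 < t -> k (r * t) = k r * k t.
  by move=> r0 t0; rewrite {1}/k -dilM dk // /k -!mulrA.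
have k1 r : 0 < r -> r < 1 -> k r < 1.
  move=> r0 r1; rewrite ltNge; apply/negP => kr1.
  have d00 : d_heis (heis0 : H) heis0 = 0 by rewrite d_heis0 // gauge0.
  have [t t0 tP] := dcvg_modulus d_metric d00 HTop e_gt0.
  have gr : (fun m : nat => r ^+ m * koranyi_gauge e) @ \oo --> (0 : R).
    rewrite -(mul0r (koranyi_gauge e)); apply: cvgMl; apply: cvg_expr.
    by rewrite ger0_norm // ltW.
  have [m _ /(_ m (leqnn m)) gm] := cvgr0_norm_lt _ gr _ t0.
  have : d heis0 (dil (r ^+ m) e) < d heis0 e.
    apply: tP; rewrite d_heis0 // gauge_dil ?exprn_ge0 ?ltW //.
    by apply: le_lt_trans gm; exact: ler_norm.
  apply/negP; rewrite -leNgt.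
  elim: m {gm} => [|m IH]; first by rewrite expr0 dil1.
  rewrite exprS -dilM dk //; apply: (le_trans IH).
  by rewrite ler_peMl // (is_metric_ge0 d_metric).
have [a a0 ka] := multiplicative_powR k_gt0 kM k1.
exists a; split=> // [|r p r0]; last by rewrite -ka // dk.
have : k 2 <= 2.
  rewrite /k ler_pdivrMr // -e_horizontal.
  apply: (le_trans (is_metric_triangle d_metric _ e _)).
  by rewrite -[in X in _ + d X _](heis_mul0 hA e) d_left_invariant mulr_natl.
by rewrite ka // -ler_ln ?posrE ?powR_gt0 // ln_powR ger_pMl // ln_gt0 // ltr1n.
Qed.

Lemma d_le_powR a : 0 < a ->
  (forall r p, 0 < r -> d heis0 (dil r p) = r `^ a * d heis0 p) ->
  exists2 b : R, 0 < b & forall p q, d p q <= b * d_heis p q `^ a.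
Proof.
move=> a0 da.
have d00 : d_heis (heis0 : H) heis0 = 0 by rewrite d_heis0 // gauge0.
have [t t0 tP] := dcvg_modulus d_metric d00 HTop ltr01.
pose c := t / 2; have c0 : 0 < c by rewrite divr_gt0.
have bound p : d heis0 p <= (c `^ a)^-1 * koranyi_gauge p `^ a.
  have [g0|g0] := eqVneq (koranyi_gauge p) 0.
    (* Continuity at the origin then makes [d heis0 p] arbitrarily small. *)
    rewrite g0 powR0 ?gt_eqF // mulr0 leNgt; apply/negP => dp.
    have [r r0 /(_ p)] := dcvg_modulus d_metric d00 HTop dp.
    by rewrite d_heis0 // g0 ltxx => /(_ r0).
  have g1 : 0 < koranyi_gauge p by rewrite lt_def g0 gauge_ge0.
  have : d heis0 (dil (c / koranyi_gauge p) p) < 1.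
    apply: tP; rewrite d_heis0 // gauge_dil // ?divr_ge0 ?ltW // divfK //.
    by rewrite /c ltr_pdivrMr // mulr_natr mulr2n ltrDl.
  have ca := powR_gt0 a c0; have ga := powR_gt0 a g1.
  have cg : (c / koranyi_gauge p) `^ a = c `^ a / koranyi_gauge p `^ a.
    by rewrite powRM ?invr_ge0 ?ltW // -powR_inv1 ?ltW // powRAC powR_inv1 ?ltW.
  rewrite da ?divr_gt0 // cg.
  move/ltW; rewrite -mulrA -ler_pdivlMl // mulr1 ler_pdivrMl //.
  by rewrite mulrC.
exists (c `^ a)^-1 => [|p q]; first by rewrite invr_gt0 powR_gt0.
by rewrite (is_metric_sym d_metric) -(d_left_invariant (heis_inv q)) heis_Vmul.
Qed.

End invariant_metrics.

(** * The real case *)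

Section real_heisenberg.
Variables (R : realType) (n : nat).
Local Notation V := 'rV[real_alg R]_(n.-1).
Local Notation H := (heis (real_alg R) n).
Implicit Types (z w u : V) (p q : H).

(** The group has no vertical direction. *)
Lemma imag_real (v : imK (real_alg R)) : sval v = 0.
Proof.
by apply/eqP; rewrite -(@eqNr R (sval v)) eq_sym; exact: (svalP v).
Qed.

Lemma real_heis_ext p q : p.1 = q.1 -> p = q.
Proof. by move=> pq; apply: heis_ext; rewrite ?imag_real. Qed.

Lemma gauge_real p : koranyi_gauge p = vnorm p.1.
Proof.
apply/eqP; rewrite -(@eqrXn2 _ 4) ?gauge_ge0 ?vnorm_ge0 //.
by rewrite gauge4 ?imag_real /= ?normr0 ?expr0n ?addr0 //; exact: normed_real.
Qed.

(** The Euclidean inner product. *)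
Definition dot z w : R := \sum_i (z 0 i : R) * (w 0 i : R).

Lemma dotC z w : dot z w = dot w z.
Proof. by apply: eq_bigr => i _; rewrite mulrC. Qed.

Lemma dotDl z z' w : dot (z + z') w = dot z w + dot z' w.
Proof. by rewrite -big_split; apply: eq_bigr => i _; rewrite mxE mulrDl. Qed.

Lemma dotZl (a : R) z w : dot (scale_row a z) w = a * dot z w.
Proof.
by rewrite mulr_sumr; apply: eq_bigr => i _; rewrite scale_rowE -mulrA.
Qed.

Lemma dotDr z w w' : dot z (w + w') = dot z w + dot z w'.
Proof. by rewrite dotC dotDl !(dotC z). Qed.

Lemma dotZr (a : R) z w : dot z (scale_row a w) = a * dot z w.
Proof. by rewrite dotC dotZl dotC. Qed.

Lemma dot_vnorm z : dot z z = vnorm z ^+ 2.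
Proof.
rewrite vnorm_sq; apply: eq_bigr => i _.
by rewrite real_normK ?num_real // expr2.
Qed.

Lemma dot_eq0 z : dot z z = 0 -> z = 0.
Proof.
move=> /eqP; rewrite psumr_eq0 => [/allP z0|i _]; last exact: sqr_ge0.
apply/rowP => i; rewrite mxE; apply/eqP.
by have := z0 i (mem_index_enum i); rewrite /= mulf_eq0 orbb.
Qed.

(** The reflection across the hyperplane orthogonal to [u]; if [u = 0] it is the
    identity, the quotient being [0]. *)
Definition reflection u z : V := z + scale_row (- (2 * dot z u / dot u u)) u.

Lemma reflectionK u : involutive (reflection u).
Proof.
move=> z; rewrite {1}/reflection dotDl dotZl.
have [u0|u0] := eqVneq (dot u u) 0.
  by apply/rowP => i; rewrite !mxE u0 !invr0 !(mulr0, oppr0) !scale0r !addr0.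
apply/rowP => i; rewrite !mxE -addrA -scalerDl.
by rewrite [X in X *: _](_ : _ = 0) ?scale0r ?addr0 //; field.
Qed.

Lemma reflectionB u z w : reflection u (z - w) = reflection u z - reflection u w.
Proof.
apply/rowP => i; rewrite !mxE -scale_rowN dotDl dotZl.
by rewrite /GRing.scale /=; ring.
Qed.

Lemma vnorm_reflection u z : vnorm (reflection u z) = vnorm z.
Proof.
apply/eqP; rewrite -(@eqrXn2 _ 2) ?vnorm_ge0 // -!dot_vnorm.
rewrite /reflection !(dotDl, dotDr, dotZl, dotZr) (dotC u z); apply/eqP.
have [u0|u0] := eqVneq (dot u u) 0; last by field.
by rewrite u0 invr0; ring.
Qed.

(** The hyperplane is the perpendicular bisector of [z] and [w]. *)
Lemma reflection_swap z w : vnorm z = vnorm w -> reflection (z - w) z = w.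
Proof.
move=> zw; have zzww : dot z z = dot w w by rewrite !dot_vnorm zw.
have zuE : dot z (z - w) = dot z z - dot z w.
  by rewrite dotDr -scale_rowN dotZr mulN1r.
have uuE : dot (z - w) (z - w) = 2 * dot z (z - w).
  rewrite zuE dotDl !dotDr -!scale_rowN !(dotZl, dotZr) -zzww (dotC w z).
  by ring.
rewrite /reflection -uuE; have [u0|u0] := eqVneq (dot (z - w) (z - w)) 0.
  have /eqP := dot_eq0 u0; rewrite subr_eq0 => /eqP ->.
  by rewrite subrr scale_row0 addr0.
by rewrite divff // scale_rowN opprB addrC subrK.
Qed.

(** The reflection as a map of the group; the vertical part is [0]. *)
Definition heis_reflection u p : H := (reflection u p.1, p.2).

Lemma heis_reflectionK u : involutive (heis_reflection u).
Proof. by move=> p; apply: real_heis_ext; exact: reflectionK. Qed.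

Lemma heis_reflection0 u : heis_reflection u heis0 = heis0.
Proof.
by apply: real_heis_ext; rewrite /= -[0](subrr 0) reflectionB !subrr.
Qed.

Lemma d_heis_reflection u p q :
  d_heis (heis_reflection u p) (heis_reflection u q) = d_heis p q.
Proof.
rewrite /d_heis !gauge_real /= -[RHS](vnorm_reflection u) ![- _ + _]addrC.
by rewrite reflectionB.
Qed.

Lemma Sim_reflection u : Sim heis0 d_heis (omap (heis_reflection u)).
Proof.
have prop : proper_at_infty heis0 d_heis (heis_reflection u).
  move=> r; exists (Num.max 1 r) => [|q]; first by rewrite lt_max ltr01.
  rewrite gt_max => /andP[_].
  by rewrite -{2}(heis_reflection0 u) d_heis_reflection.
apply: (@Sim_omap _ _ _ _ _ (heis_reflection u) 1) => //.
- exact: heis_reflectionK.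
- exact: heis_reflectionK.
- by move=> p q; rewrite mul1r d_heis_reflection.
Qed.

Variable d : H -> H -> R.
Hypothesis d_metric : is_metric d.
Hypothesis HSim : Sim heis0 d_heis `<=` Sim heis0 d.
Variable e : H.
Hypothesis e_neq0 : e != heis0.

Lemma d_reflection u p q :
  d (heis_reflection u p) (heis_reflection u q) = d p q.
Proof.
have [k k0 dk] := Sim_omap_scale (HSim (Sim_reflection u)).
have : k ^+ 2 == 1.
  have e0 : d heis0 e != 0 by rewrite gt_eqF // d_gt0 // eq_sym.
  apply/eqP/(mulIf e0); rewrite expr2 -mulrA -!dk.
  by rewrite !heis_reflectionK mul1r.
by rewrite pexpr_eq1 ?ltW // => /eqP k1; rewrite dk k1 mul1r.
Qed.

(** [d heis0] is constant on the spheres centred at the origin. *)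
Lemma d_sphere p q : koranyi_gauge p = koranyi_gauge q -> d heis0 p = d heis0 q.
Proof.
rewrite !gauge_real => /reflection_swap pq.
rewrite -(d_reflection (p.1 - q.1)) heis_reflection0; congr d.
exact: real_heis_ext.
Qed.

Lemma d_eq_powR a : 0 < a ->
  (forall s p q, d (heis_mul s p) (heis_mul s q) = d p q) ->
  (forall r p, 0 < r -> d heis0 (dil r p) = r `^ a * d heis0 p) ->
  exists2 b : R, 0 < b & forall p q, d p q = b * d_heis p q `^ a.
Proof.
move=> a0 inv da; have hA := normed_real R.
have gauge_eq0 p : koranyi_gauge p = 0 -> p = heis0.
  rewrite gauge_real => p0; apply: real_heis_ext; apply: dot_eq0.
  by rewrite dot_vnorm p0 expr0n.
have gauge_gt0 p : p != heis0 -> 0 < koranyi_gauge p.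
  by rewrite lt_def gauge_ge0 andbT; apply: contra_neq => /gauge_eq0.
have e1 := gauge_gt0 _ e_neq0.
have dE p : d heis0 p = d heis0 e / koranyi_gauge e `^ a * koranyi_gauge p `^ a.
  have [->|p0] := eqVneq p heis0.
    by rewrite gauge0 // powR0 ?gt_eqF // mulr0 d_xx.
  have p1 := gauge_gt0 _ p0.
  pose r := koranyi_gauge p / koranyi_gauge e.
  have r0 : 0 < r by exact: divr_gt0.
  have <- : d heis0 (dil r e) = d heis0 p.
    by apply: d_sphere; rewrite gauge_dil ?ltW // divfK // gt_eqF.
  rewrite da // -[in RHS](divfK (lt0r_neq0 e1) (koranyi_gauge p)) -/r.
  rewrite (powRM _ (ltW r0) (ltW e1)).
  by field; rewrite gt_eqF // powR_gt0.
exists (d heis0 e / koranyi_gauge e `^ a) => [|p q].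
  apply: divr_gt0; last exact: powR_gt0.
  by apply: d_gt0 => //; rewrite eq_sym.
by rewrite (is_metric_sym d_metric) -(inv (heis_inv q)) heis_Vmul.
Qed.

End real_heisenberg.

(** * Comparison of [d] with the Koranyi metric *)

Theorem theorem1p1 (R : realType) (K : algLabel) (n : nat)
    (n_ge2 : (2 <= n)%N) (n_oct : K = OctonionK -> n = 2%N)
    (d : heis (alg R K) n -> heis (alg R K) n -> R)
    (d_metric : is_metric d)
    (HSim : Sim heis0 d_heis `<=` Sim heis0 d)
    (HTop : forall p : nat -> option (heis (alg R K) n),
        dcvg heis0 d_heis p -> dcvg heis0 d p) :
  (K = RealK ->
    exists alpha beta : R, [/\ 0 < alpha, alpha <= 1, 0 < beta &
      forall p q : option (heis (alg R K) n),
        dext d p q = (beta%:E * dext d_heis p q `^ alpha)%E]) /\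
  (K <> RealK ->
    exists alpha beta : R, [/\ 0 < alpha, alpha <= 1, 0 < beta &
      forall p q : option (heis (alg R K) n),
        (dext d p q <= beta%:E * dext d_heis p q `^ alpha)%E]).
Proof.
have hA := normed_alg R K.
have [e e_neq0 eE] := exists_horizontal hA n_ge2.
have [a [a0 a1 da]] := dilation_exponent hA d_metric HSim HTop e_neq0 eE.
have inv := d_left_invariant hA d_metric HSim e_neq0.
have an0 : a != 0 by rewrite gt_eqF.
split=> [KR|_].
  subst K; have [b b0 db] := d_eq_powR d_metric HSim e_neq0 a0 inv da.
  exists a, b; split=> // -[p|] [q|] /=.
  - by rewrite -EFinM -db.
  - by rewrite (negbTE an0) gt0_muley ?lte_fin.
  - by rewrite (negbTE an0) gt0_muley ?lte_fin.
  - by rewrite powR0 // mule0.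
have [b b0 db] := d_le_powR hA d_metric HSim HTop e_neq0 a0 da.
exists a, b; split=> // -[p|] [q|] /=.
- by rewrite -EFinM lee_fin.
- by rewrite (negbTE an0) gt0_muley ?lte_fin.
- by rewrite (negbTE an0) gt0_muley ?lte_fin.
- by rewrite powR0 // mule0.
Qed.
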